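(* There is an absolute constant $C$ such that for every integer $n\ge 1$, every stable matching instance with $n$ jobs and $n$ applicants has at most $3.55^n + C$ stable matchings. Equivalently, the maximum possible number $SM(n)$ of stable matchings in an instance with $n$ jobs and $n$ applicants satisfies $SM(n)\le 3.55^n+O(1)$.
   Context: A stable matching instance with $n$ jobs and $n$ applicants is a complete bipartite graph $G$ with an $n$-vertex class of jobs and an $n$-vertex class of applicants, where each vertex has a strict linear order of preferences on the vertices of the opposite class. Given a perfect matching in $G$, a pair $u,v$ (a job and an applicant not matched to each other) is unstable if $u$ and $v$ both prefer each other to their currently matched partners. A perfect matching that contains no unstable pair is a stable matching. $SM(n)$ denotes the maximum number of stable matchings over all instances with $n$ jobs and $n$ applicants. *)

(* Defs.v *)
From mathcomp Require Import all_boot all_order all_algebra.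

Set Implicit Arguments.
Unset Strict Implicit.
Unset Printing Implicit Defensive.

Definition strict_linear (T : finType) (r : T -> T -> bool) : bool :=
  [&& [forall x, ~~ r x x],
      [forall x, forall y, forall z, r x y && r y z ==> r x z]
    & [forall x, forall y, (x != y) ==> r x y || r y x]].

(* For [p : prefs U V], [p u v w] means that [u] strictly prefers [v] to [w].
   Finite functions are used so that the instances form a finType, over which
   a maximum can be taken. *)
Definition prefs (U V : finType) := {ffun U -> {ffun V -> {ffun V -> bool}}}.

Definition valid_prefs (U V : finType) (p : prefs U V) : bool :=
  [forall u, strict_linear (fun v w => p u v w)].

Definition sm_instance (J A : finType) :=
  {p : prefs J A * prefs A J | valid_prefs p.1 && valid_prefs p.2}.

Definition job_pref (J A : finType) (I : sm_instance J A) : prefs J A :=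
  (val I).1.

Definition app_pref (J A : finType) (I : sm_instance J A) : prefs A J :=
  (val I).2.

(* A matching is a set of edges of the complete bipartite graph on J and A. *)
Definition perfect_matching (J A : finType) (M : {set J * A}) : bool :=
  [forall j, #|[set a | (j, a) \in M]| == 1] &&
  [forall a, #|[set j | (j, a) \in M]| == 1].

Definition unstable_pair (J A : finType) (I : sm_instance J A)
    (M : {set J * A}) (j : J) (a : A) : bool :=
  ((j, a) \notin M) &&
  [exists j', exists a',
    [&& (j, a') \in M, (j', a) \in M, job_pref I j a a' & app_pref I a j j']].

Definition stable_matching (J A : finType) (I : sm_instance J A)
    (M : {set J * A}) : bool :=
  perfect_matching M && [forall j, forall a, ~~ unstable_pair I M j a].

Definition num_stable (J A : finType) (I : sm_instance J A) : nat :=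
  #|[set M : {set J * A} | stable_matching I M]|.

Definition SM (n : nat) : nat :=
  \max_(I : sm_instance 'I_n 'I_n) num_stable I.

(* Main.v *)
Require Import Defs.
From mathcomp Require Import all_boot all_order all_algebra all_fingroup.
From mathcomp Require Import zify ring lra reals exp Rstruct.

(** The bound holds with [C = 0], and comes from an entropy argument.  Let [S]
    be the set of stable matchings, seen as functions from jobs to applicants,
    and let [f] be uniform in [S].  Reveal the values of [f] one job at a time,
    the jobs coming in some order [o], and let [N o f j] be the number of
    applicants that job [j] can still get, given the values revealed before
    [j].  Guessing each value uniformly among those still possible gives [f]
    with probability [prod_j 1 / N o f j], and these probabilities add up to at
    most 1 ([kraft]).  With [ln x <= x - 1] this becomes the entropy bound
    [ln #|S| <= E_f (sum_j ln (N o f j))] for every [o], and therefore also on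
    average over a uniformly random order [o].

    It remains to bound the average over [o] of [ln (N o f j)] for fixed [f]
    and [j].  List the applicants that [j] gets in some stable matching by
    decreasing preference of [j].  If such an applicant [a], other than [f j],
    is matched to a job that comes before [j], then the position of [a] in the
    list is known to be above or below [f j]: [a] and [j] have opposite
    opinions on any two stable matchings of which one matches them to each
    other ([opposite_interests]), so whether [a] prefers its revealed partner
    to [j] tells on which side of [a] the partner of [j] lies ([no_crossing]).
    So the possible values of [f j] lie in the stretch of the list around [f j]
    where no applicant has been revealed.

    If [N o f j >= k], then [j] comes first among the partners of the
    applicants in some window of [k] consecutive positions around [f j].  For
    one window of [k] jobs this has probability [1 / k], and for two adjacent
    ones at once [1 / (k + 1)]; combining the at most [k] windows yields
    [P (N o f j >= k) <= 2 / (k + 1)] ([window_count], [reveal_tail]).  Hence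
      [E_o (ln (N o f j)) <= sum_(k >= 1) (ln (k + 1) - ln k) * 2 / (k + 2)].
    Keeping the terms [k = 1, 2] and using [ln (k + 1) - ln k <= 1 / k] in the
    others, which makes them telescope, bounds the sum by
    [2/3 ln 2 + 1/2 ln (3/2) + 7/12 < ln 3.55] ([sum_log_step_le]). *)

Set Implicit Arguments.
Unset Strict Implicit.
Unset Printing Implicit Defensive.

(** * Opposite interests of the two sides *)

Section Stable.
Variables (J A : finType) (I : sm_instance J A).

(** The function sending each job to its partner carries all of a perfect
    matching.  A pair blocking it is always a job [i] together with the value
    [f j] of another job, so that no inverse function enters the definition. *)
Definition stable_assignment (f : {ffun J -> A}) : bool :=
  injectiveb f &&
  [forall i, forall j,
     ~~ (job_pref I i (f j) (f i) && app_pref I (f j) i j)].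

Lemma job_prefP j :
  [/\ irreflexive (fun a b => job_pref I j a b),
      transitive (fun a b => job_pref I j a b)
    & forall a b, a != b -> job_pref I j a b || job_pref I j b a].
Proof.
have /andP[/forallP/(_ j)/and3P[/forallP irr tr tot] _] := valP I.
split=> [a|b a c ab bc|a b]; first exact/negbTE/irr.
  move/forallP/(_ a)/forallP/(_ b)/forallP/(_ c)/implyP: tr; apply.
  exact/andP.
by move/forallP/(_ a)/forallP/(_ b)/implyP: tot.
Qed.

Lemma app_prefP a :
  [/\ irreflexive (fun i j => app_pref I a i j),
      transitive (fun i j => app_pref I a i j)
    & forall i j, i != j -> app_pref I a i j || app_pref I a j i].
Proof.
have /andP[_ /forallP/(_ a)/and3P[/forallP irr tr tot]] := valP I.
split=> [i|j i k ij jk|i j]; first exact/negbTE/irr.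
  move/forallP/(_ i)/forallP/(_ j)/forallP/(_ k)/implyP: tr; apply.
  exact/andP.
by move/forallP/(_ i)/forallP/(_ j)/implyP: tot.
Qed.

Definition stable_assignments : {set {ffun J -> A}} :=
  [set f | stable_assignment f].

Lemma num_stable_le : num_stable I <= #|stable_assignments|.
Proof.
pose graph (f : {ffun J -> A}) := [set e | f e.1 == e.2].
apply: leq_trans (leq_imset_card graph _); apply/subset_leq_card/subsetP => M.
rewrite inE => /andP[/andP[/forallP onJ /forallP onA] /forallP noblock].
have /fin_all_exists[f fP] j : exists a, [set a | (j, a) \in M] = [set a].
  exact/cards1P.
have fE j a : ((j, a) \in M) = (f j == a).
  by have := congr1 (fun s : {set A} => a \in s) (fP j); rewrite !inE eq_sym.
have f_inj : injective f.
  move=> i j fij; have /cards1P[k kP] := onA (f j).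
  have inM l : (f l == f j) = (l == k).
    rewrite -fE; have := congr1 (fun s : {set J} => l \in s) kP.
    by rewrite !inE.
  by move: (inM i) (inM j); rewrite fij eqxx => /esym/eqP-> /esym/eqP->.
apply/imsetP; exists [ffun j => f j]; last first.
  by apply/setP=> -[j a]; rewrite inE ffunE fE.
rewrite inE; apply/andP; split.
  by apply/injectiveP=> i j; rewrite !ffunE => /f_inj.
apply/forallP=> i; apply/forallP=> j; rewrite !ffunE; apply/negP=> /andP[pi pj].
have /forallP/(_ (f j))/negP[] := noblock i.
rewrite /unstable_pair fE; apply/andP; split.
  by apply: contraTN pi => /eqP->; have [-> _ _] := job_prefP i.
apply/existsP; exists j; apply/existsP; exists (f i).
by rewrite !fE !eqxx pi pj.
Qed.

Lemma stable_inj f : stable_assignment f -> injective f.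
Proof. by case/andP=> /injectiveP. Qed.

Lemma stable_app_pref f i j :
  stable_assignment f -> i != j -> job_pref I i (f j) (f i) ->
  app_pref I (f j) j i.
Proof.
case/andP=> _ /forallP/(_ i)/forallP/(_ j) + ij pij; rewrite pij /=.
by have [_ _ /(_ _ _ ij)/orP[->|]] := app_prefP (f j).
Qed.

Lemma stable_job_pref f i j :
  stable_assignment f -> i != j -> app_pref I (f j) i j ->
  job_pref I i (f i) (f j).
Proof.
move=> sf ij; case/andP: (sf) => _ /forallP/(_ i)/forallP/(_ j) + aij.
rewrite aij andbT; have [_ _] := job_prefP i => /(_ (f j) (f i)).
rewrite (inj_eq (stable_inj sf)) eq_sym => /(_ ij)/orP[->//|//].
Qed.

Hypothesis cardJA : #|J| = #|A|.

(** If [j] prefers [f] to [h], then its partner in [h] prefers [h] to [f].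
    Let [P] be the set of jobs that prefer [f].  By stability of [h], the
    [f]-partner of a job of [P] prefers [h], and then, by stability of [f], its
    [h]-partner lies in [P].  So [f @: P] is contained in [h @: P], and the two
    are equal because they have the same cardinality; hence [h j] is the
    [f]-partner of a job of [P]. *)
Lemma opposite_interests f h i j :
  stable_assignment f -> stable_assignment h -> h j = f i -> i != j ->
  job_pref I j (f j) (h j) -> app_pref I (h j) j i.
Proof.
move=> sf sh hjfi ij fj_hj.
pose P := [set l | job_pref I l (f l) (h l)].
have f_h l : exists l', h l' = f l.
  have [h' _ hK] := inj_card_bij (stable_inj sh) (eq_leq (esym cardJA)).
  by exists (h' (f l)).
have PQ l l' : l \in P -> h l' = f l -> app_pref I (h l') l' l.
  rewrite inE => Pl hl'; apply: stable_app_pref => //; last by rewrite hl'.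
  apply: contraTneq Pl => ll'; have [irr _ _] := job_prefP l.
  by rewrite -hl' -ll' irr.
have neq l l' : l \in P -> h l' = f l -> l' != l.
  move=> /PQ Pl /Pl; apply: contraTneq => ->.
  by have [-> _ _] := app_prefP (h l).
have fPhP : f @: P \subset h @: P.
  apply/subsetP=> _ /imsetP[l Pl ->]; have [l' hl'] := f_h l.
  rewrite -hl' imset_f // inE hl'; apply: stable_job_pref => //.
    exact: neq Pl hl'.
  by rewrite -hl'; apply: PQ.
have /eqP fhP : f @: P == h @: P.
  rewrite eqEcard fPhP (card_imset _ (stable_inj sf)).
  by rewrite (card_imset _ (stable_inj sh)) /=.
have : h j \in f @: P by rewrite fhP imset_f // inE.
case/imsetP=> l Pl hjfl.
by have /(stable_inj sf)<- : f l = f i; [rewrite -hjfl | apply: PQ].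
Qed.

(** The applicant [h j] is matched to [i] by both [f] and [g], and compares [i]
    with [j] in one way only, so that [f j] and [g j] cannot lie on different
    sides of [h j] in the preferences of [j].  This is how revealed pairs
    restrict the partner of [j]. *)
Lemma no_crossing f g h i j :
  stable_assignment f -> stable_assignment g -> stable_assignment h ->
  i != j -> f i = h j -> g i = h j ->
  job_pref I j (f j) (h j) -> job_pref I j (h j) (g j) -> False.
Proof.
move=> sf sg sh ij fi gi fh hg.
have a_j_i := opposite_interests sf sh (esym fi) ij fh.
have a_i_j : app_pref I (h j) i j.
  by rewrite -gi; apply: (stable_app_pref sg); rewrite ?gi // eq_sym.
have [irr tr _] := app_prefP (h j).
by have := tr _ _ _ a_j_i a_i_j; rewrite irr.
Qed.

End Stable.

(** * Guessing a function value by value *)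

Section Kraft.
Import Order.TTheory GRing.Theory Num.Theory.
Local Open Scope ring_scope.
Variables (J A : finType).
Implicit Types (S : {set {ffun J -> A}}) (f : {ffun J -> A}) (s : seq J).

Definition options S s f j : {set A} :=
  [set (g : {ffun J -> A}) j | g in [set g in S | all (fun i => g i == f i) s]].

Lemma options_nil S f j :
  options S [::] f j = [set (g : {ffun J -> A}) j | g in S].
Proof.
rewrite /options; have -> // : [set g in S | true] = S.
by apply/setP=> g; rewrite inE andbT.
Qed.

Lemma options_cons S i s f j :
  options S (i :: s) f j = options [set g in S | g i == f i] s f j.
Proof.
rewrite /options; congr [set _ j | _ in _]; congr pred_of_set.
by apply/setP=> g; rewrite !inE andbA.
Qed.

Lemma mem_options S s f j : f \in S -> f j \in options S s f j.
Proof.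
by move=> Sf; apply/imset_f; rewrite inE Sf; apply/allP.
Qed.

(** The left-hand side adds up the probabilities of guessing [f] when its
    values along [s] are guessed one after the other, each uniformly among the
    [options] left by the previous values.  The induction reveals the first
    value [f j = a]: the functions with that value form the [slice] of [a],
    the induction hypothesis gives at most 1 for each slice, and the factor of
    [j] is the inverse of the number of nonempty slices. *)
Lemma kraft (R : realFieldType) s : uniq s -> forall S,
  (forall f g, f \in S -> g \in S -> {in s, f =1 g} -> f = g) ->
  \sum_(f in S)
    \prod_(j <- s) (#|options S (take (index j s) s) f j|%:R)^-1 <= 1 :> R.
Proof.
elim: s => [_ S sep|j s IH /= /andP[js us] S sep].
  under eq_bigr do rewrite big_nil.
  rewrite sumr_const -[1]/1%:R ler_nat; apply/card_le1_eqP=> f g Sf Sg.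
  exact: sep.
pose V := [set (g : {ffun J -> A}) j | g in S].
pose slice a := [set g in S | g j == a].
have prodE f : f \in S ->
  \prod_(i <- j :: s)
     (#|options S (take (index i (j :: s)) (j :: s)) f i|%:R)^-1
  = #|V|%:R^-1 * \prod_(i <- s)
     (#|options (slice (f j)) (take (index i s) s) f i|%:R)^-1 :> R.
  move=> Sf; rewrite big_cons /= eqxx take0 options_nil; congr (_ * _).
  rewrite 2!big_seq; apply: eq_bigr => i si.
  have -> : (j == i) = false by apply: contraNF js => /eqP->.
  by rewrite /= options_cons.
rewrite (eq_bigr _ prodE) (partition_big (fun f => f j) (mem V)); last first.
  by move=> f Sf; apply: imset_f.
apply: (@le_trans _ _ (\sum_(a in V) #|V|%:R^-1)).
  apply: ler_sum => a _.
  under eq_bigr => f /andP[_ /eqP fja] do rewrite fja.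
  rewrite -mulr_sumr ler_piMr ?invr_ge0 ?ler0n //.
  apply: le_trans (IH us (slice a) _).
    by rewrite le_eqVlt; apply/orP; left; apply/eqP/eq_bigl => f; rewrite inE.
  move=> f g; rewrite !inE => /andP[Sf /eqP fj] /andP[Sg /eqP gj] fg.
  apply: sep => // i; rewrite inE => /predU1P[->|]; last exact: fg.
  by rewrite fj gj.
rewrite sumr_const -[_ *+ _]mulr_natr.
by have [->|V0] := eqVneq #|V| 0%N; rewrite ?mulr0 // mulVf // pnatr_eq0.
Qed.
End Kraft.

(** * Windows in a random order *)

Section RandomOrder.
Variable J : finType.
Implicit Types (o : {perm J}) (W : {set J}).

Definition listing o : seq J := [seq o j | j <- enum J].

Definition rank o j := index j (listing o).

Lemma listing_uniq o : uniq (listing o).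
Proof. by rewrite map_inj_uniq ?enum_uniq //; apply: perm_inj. Qed.

Lemma mem_listing o j : j \in listing o.
Proof. by apply/mapP; exists ((o^-1)%g j); rewrite ?mem_enum ?permKV. Qed.

Lemma rank_inj o : injective (rank o).
Proof.
move=> i j eqr; rewrite -(nth_index i (mem_listing o i)) -/(rank o i) eqr.
exact: nth_index (mem_listing o j).
Qed.

Lemma rankM o (t : {perm J}) j : rank (o * t) (t j) = rank o j.
Proof.
rewrite /rank /listing.
have -> : [seq (o * t)%g i | i <- enum J] = [seq t i | i <- listing o].
  by rewrite /listing -map_comp; apply: eq_map => i /=; rewrite permM.
exact/index_map/perm_inj.
Qed.

Definition leads W j : {set {perm J}} :=
  [set o | [forall w in W, rank o j <= rank o w]].

(** Composing the order with a transposition of two elements of [W] exchanges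
    the roles of these elements, so that each element of [W] comes first
    equally often. *)
Lemma card_leads W j : j \in W -> #|leads W j| * #|W| = #|{perm J}|.
Proof.
move=> Wj; have eq_leads i : i \in W -> #|leads W i| = #|leads W j|.
  move=> Wi; pose t := tperm i j.
  have tW w : w \in W -> t w \in W by rewrite /t; case: tpermP => // ->.
  rewrite -(card_imset (leads W j) (mulIg t)); apply: eq_card => o.
  have rank_t o' k : rank (o' * t)%g k = rank o' (t k).
    by rewrite -{1}(tpermK i j k) rankM.
  apply/idP/imsetP=> [|[o' + ->]]; rewrite !inE => /forall_inP oP.
    exists (o * t)%g; last by rewrite -mulgA tperm2 mulg1.
    rewrite inE; apply/forall_inP=> w Ww.
    by rewrite !rank_t tpermR oP // tW.
  by apply/forall_inP=> w Ww; rewrite !rank_t tpermL oP // tW.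
rewrite mulnC -sum_nat_const -(eq_bigr _ eq_leads).
transitivity (\sum_(o : {perm J}) 1); last by rewrite sum1_card cardT.
under eq_bigr do rewrite -sum1_card big_mkcond /=.
rewrite exchange_big /=; apply: eq_bigr => o _; rewrite -big_mkcondr /=.
have [k Wk kmin] := arg_minnP (rank o) Wj.
rewrite (bigD1 k) /=; last first.
  by rewrite [k \in W]Wk inE; apply/forall_inP.
rewrite big1 ?addn0 // => i /andP[/andP[Wi]]; rewrite inE => /forall_inP iP.
move/negP=> []; apply/eqP/(@rank_inj o)/eqP.
by rewrite eqn_leq iP // kmin.
Qed.

Variables (w : nat -> J) (m p : nat).
Hypotheses (w_inj : forall q r, q < m -> r < m -> w q = w r -> q = r).
Hypothesis (pm : p < m).

Definition window k x : {set J} := [set w (x + i) | i : 'I_k].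

Lemma card_window k x : x + k <= m -> #|window k x| = k.
Proof.
move=> xk; rewrite card_imset ?card_ord // => i j /w_inj eqij.
have lt (l : 'I_k) : x + l < m by apply: leq_trans xk; rewrite ltn_add2l.
by apply/val_inj/(@addnI x)/eqij.
Qed.

Definition leads_window k x := leads (window k x) (w p).

Lemma leads_windowP k x o :
  reflect (forall q, x <= q < x + k -> rank o (w p) <= rank o (w q))
          (o \in leads_window k x).
Proof.
rewrite inE; apply: (iffP forall_inP).
  move=> oP q /andP[xq qk].
  have qx : q - x < k by rewrite ltn_subLR.
  by apply: oP; apply/imsetP; exists (Ordinal qx); rewrite //= subnKC.
move=> oP _ /imsetP[i _ ->].
by apply: oP; rewrite leq_addr ltn_add2l ltn_ord.
Qed.

Lemma leads_windowS k x : 0 < k ->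
  leads_window k.+1 x = leads_window k x :&: leads_window k x.+1.
Proof.
move=> k0; apply/setP=> o; rewrite in_setI.
apply/leads_windowP/andP => [oP|[/leads_windowP oP /leads_windowP oP'] q].
  split; apply/leads_windowP => q /andP[xq qk]; apply: oP.
    by rewrite xq addnS ltnS ltnW.
  by rewrite (ltnW xq) -addSnnS.
rewrite -addSnnS => /andP[xq qk]; have [qx|qx] := ltnP q (x + k).
  by apply: oP; rewrite xq.
by apply: oP'; rewrite qk (leq_trans _ qx) // -addn1 leq_add2l.
Qed.

Lemma card_leads_window k x : x <= p < x + k -> x + k <= m ->
  #|leads_window k x| * k = #|{perm J}|.
Proof.
move=> /andP[xp pk] km; rewrite -(card_leads (j := w p) (W := window k x)).
  by rewrite card_window.
have px : p - x < k by rewrite ltn_subLR.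
by apply/imsetP; exists (Ordinal px); rewrite //= subnKC.
Qed.

(** For a random order, the probability that [w p] comes first in some window
    of length [k] around [p] is at most [2 / (k + 1)].  Add the windows from
    right to left: the rightmost one has probability [1 / k], and each of the
    at most [k - 1] others adds at most [1 / k - 1 / (k + 1)], because coming
    first both in a window and in the next one amounts to coming first in a
    window of length [k + 1]. *)
Lemma window_count k (B : {set {perm J}}) : 0 < k ->
  (forall o, o \in B -> exists x,
     [/\ x <= p, p < x + k, x + k <= m
       & forall q, x <= q < x + k -> rank o (w p) <= rank o (w q)]) ->
  #|B| * k.+1 <= 2 * #|{perm J}|.
Proof.
move=> k0 BP; set P := #|{perm J}|.
have [->|[o0 /BP[x0 [x0p px0 x0m _]]]] := set_0Vmem B; first by rewrite cards0.
(* the extreme starts of a window around p inside [0, m) *)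
pose lo := p.+1 - k; pose hi := minn p (m - k).
have lohi : lo <= hi by rewrite /lo /hi; lia.
have in_range x : lo <= x <= hi -> (x <= p < x + k) /\ x + k <= m.
  by rewrite /lo /hi; lia.
pose a := #|leads_window k hi|.
have cardE x : lo <= x <= hi -> #|leads_window k x| = a.
  have card_k y : lo <= y <= hi -> #|leads_window k y| * k = P.
    by move=> /in_range[]; apply: card_leads_window.
  move=> xr; apply/eqP; rewrite -(eqn_pmul2r k0) card_k // card_k //.
  by rewrite lohi leqnn.
have aP : a * k = P.
  by have [] := in_range hi; rewrite ?lohi ?leqnn //; apply: card_leads_window.
pose b := #|leads_window k.+1 lo|.
have cardSE x : lo <= x < hi -> #|leads_window k.+1 x| = b.
  have card_k y : lo <= y < hi -> #|leads_window k.+1 y| * k.+1 = P.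
    move=> yr; have [] := in_range y; first lia.
    have [] := in_range y.+1; first lia.
    by move=> ? ? ? ?; apply: card_leads_window; lia.
  move=> xr; apply/eqP; rewrite -(eqn_pmul2r (ltn0Sn k)) card_k // card_k //.
  lia.
have cover d : d <= hi - lo -> exists U : {set {perm J}},
    (forall x, hi - d <= x <= hi -> leads_window k x \subset U) /\
    #|U| <= a + d * (a - b).
  elim: d => [_|d IH dhi].
    exists (leads_window k hi); split=> [x xr|]; last by rewrite mul0n addn0.
    by have -> : x = hi by lia.
  have [|U [sub cardU]] := IH; first lia.
  set y := hi - d.+1; exists (U :|: leads_window k y); split=> [x xr|].
    have [->|xy] := eqVneq x y; first exact: subsetUr.
    by apply: subset_trans (subsetUl _ _); apply: sub; lia.
  (* only the orders outside of the event of the next window are new *)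
  have -> : U :|: leads_window k y =
            U :|: (leads_window k y :\: leads_window k y.+1).
    apply/setP=> o; rewrite !in_setU in_setD.
    have /subsetP/(_ o) : leads_window k y.+1 \subset U by apply: sub; lia.
    by case: (o \in leads_window k y.+1) => //= ->.
  have cardD : #|leads_window k y :\: leads_window k y.+1| = a - b.
    by rewrite cardsD -leads_windowS // cardE ?cardSE //; lia.
  by have := (cardsU U (leads_window k y :\: leads_window k y.+1)); lia.
have [U [sub cardU]] := cover _ (leqnn _).
have BU : #|B| <= #|U|.
  apply/subset_leq_card/subsetP=> o /BP[x [xp px xm oP]].
  have /subsetP-> // : leads_window k x \subset U.
    by apply: sub; rewrite /lo /hi; lia.
  exact/leads_windowP.
have [lohi'|] := ltnP lo hi; last first.
  rewrite -subn_eq0 => /eqP d0; rewrite d0 mul0n addn0 in cardU.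
  by rewrite -aP; nia.
have bP : b * k.+1 = P.
  have [] := in_range lo; first lia.
  have [] := in_range lo.+1; first lia.
  by move=> ? ? ? ?; apply: card_leads_window; lia.
have dk : hi - lo <= k.-1 by rewrite /lo /hi; lia.
nia.
Qed.

End RandomOrder.

Lemma fit_window k lo p hi : lo <= p -> p <= hi -> k <= (hi - lo).+1 -> 0 < k ->
  exists x, [/\ x <= p, p < x + k, lo <= x & x + k <= hi.+1].
Proof. by move=> *; exists (maxn lo (p.+1 - k)); split; lia. Qed.

(** * The number of partners left for a job *)

Section Reveal.
Variables (J A : finType) (I : sm_instance J A).
Hypothesis cardJA : #|J| = #|A|.
Let S := stable_assignments I.

(** Along the list [c] of the stable partners of [j], sorted by preference, the
    [options] of [j] lie between positions [lo] and [hi], and [f j] is at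
    position [p].  No applicant between [lo] and [hi] is matched by [f] to a
    job revealed before [j]: otherwise its place relative to the partner of [j]
    would be known, and one of the options at [lo] and [hi] would be excluded
    by [no_crossing].  So [j] comes first in a whole window of [k] positions
    around [p]. *)
Lemma reveal_tail f j k : f \in S -> 0 < k ->
  #|[set o : {perm J} |
      k <= #|options S (take (rank o j) (listing o)) f j|]| * k.+1
  <= 2 * #|{perm J}|.
Proof.
move=> Sf k0; have sf : stable_assignment I f by rewrite inE in Sf.
have SP g : g \in S -> stable_assignment I g by rewrite inE.
pose V := [set (g : {ffun J -> A}) j | g in S].
pose le a b := (a == b) || job_pref I j a b.
pose c := sort le (enum V).
have [irr tr tot] := job_prefP I j.
have c_uniq : uniq c by rewrite sort_uniq enum_uniq.
have memc a : (a \in c) = (a \in V) by rewrite mem_sort mem_enum.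
have le_tr : transitive le.
  move=> b a d /predU1P[->//|ab] /predU1P[<-|bd]; apply/orP; right=> //.
  exact: tr ab bd.
have le_tot : total le.
  move=> a b; rewrite /le [b == a]eq_sym.
  by have [->|/tot/orP[]->] := eqVneq a b; rewrite ?orbT.
have sorted_c : sorted le c by exact: sort_sorted.
have prefc a b :
    a \in c -> b \in c -> index a c < index b c -> job_pref I j a b.
  move=> ca cb ab; have := sorted_ltn_index le_tr sorted_c a b ca cb ab.
  by case/predU1P=> // eqab; rewrite eqab ltnn in ab.
have [f' f'K f'KV] := inj_card_bij (stable_inj sf) (eq_leq (esym cardJA)).
pose w q := f' (nth (f j) c q); pose p := index (f j) c; pose m := size c.
have fjV : f j \in c by rewrite memc; apply: imset_f.
have pm : p < m by rewrite index_mem.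
have wp : w p = j by rewrite /w nth_index.
have w_inj q r : q < m -> r < m -> w q = w r -> q = r.
  by move=> qm rm /(can_inj f'KV)/eqP; rewrite nth_uniq // => /eqP.
apply: (window_count w_inj pm k0) => o; rewrite inE.
set B := options _ _ _ _ => kB.
have fjB : f j \in B by apply: mem_options.
have BP b : b \in B -> exists2 g, g \in S &
    b = g j /\ forall i, rank o i < rank o j -> g i = f i.
  case/imsetP=> g; rewrite inE => /andP[Sg /allP gf] ->; exists g => //.
  split=> // i ij; apply/eqP/gf.
  by rewrite (in_take _ (mem_listing o i)).
have BV b : b \in B -> b \in c.
  by move=> /BP[g Sg [-> _]]; rewrite memc; apply: imset_f.
have [bl Bbl minl] := arg_minnP (fun b => index b c) fjB.
have [bh Bbh maxh] := arg_maxnP (fun b => index b c) fjB.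
set lo := index bl c in minl; set hi := index bh c in maxh.
have lop : lo <= p by apply: minl.
have phi : p <= hi by apply: maxh.
have him : hi < m by rewrite index_mem BV.
have size_B : #|B| <= (hi - lo).+1.
  rewrite cardE -(size_map (fun b => index b c)).
  rewrite -(size_iota lo (hi - lo).+1); apply: uniq_leq_size.
    rewrite map_inj_in_uniq ?enum_uniq // => a b.
    rewrite !mem_enum => /BV ca /BV cb eqab.
    by rewrite -(nth_index (f j) ca) eqab nth_index.
  move=> _ /mapP[b + ->]; rewrite mem_enum => Bb; rewrite mem_iota.
  rewrite [lo <= _]minl // addnS ltnS subnKC ?(leq_trans lop phi) //.
  exact: maxh.
have unrevealed q : lo <= q <= hi -> rank o (w p) <= rank o (w q).
  rewrite wp => /andP[loq qhi]; rewrite leqNgt; apply/negP=> lt_qj.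
  pose a := nth (f j) c q; have qm : q < m by apply: leq_ltn_trans him.
  have ca : a \in c by apply: mem_nth.
  have idxa : index a c = q by rewrite index_uniq.
  have wqj : w q != j by apply: contraTneq lt_qj => ->; rewrite ltnn.
  have fwq : f (w q) = a by rewrite /w f'KV.
  have qp : q != p by apply: contraNneq wqj => ->; rewrite wp.
  have [h Sh ahj] : exists2 h, h \in S & a = h j.
    by move: ca; rewrite memc => /imsetP[h]; exists h.
  (* compare f j with the extreme option on the other side of a *)
  have [ltqp|ltpq|eqp] := ltngtP q p; last by rewrite eqp eqxx in qp.
    have [g Sg [eqb gf]] := BP _ Bbl.
    have gwq : g (w q) = a by rewrite gf.
    have lq : lo < q.
      rewrite ltn_neqAle loq andbT; apply: contraNneq wqj => eql.
      apply/eqP/(stable_inj (SP _ Sg)).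
      by rewrite gwq -eqb -(nth_index (f j) (BV _ Bbl)) -/lo eql.
    apply: (no_crossing cardJA (SP _ Sg) sf (SP _ Sh) wqj); rewrite -?ahj //.
      by rewrite -eqb; apply: prefc; [exact: BV | exact: ca | rewrite idxa].
    by apply: prefc; [exact: ca | exact: fjV | rewrite idxa].
  have [g Sg [eqb gf]] := BP _ Bbh.
  have gwq : g (w q) = a by rewrite gf.
  have qh : q < hi.
    rewrite ltn_neqAle qhi andbT; apply: contraNneq wqj => eqh.
    apply/eqP/(stable_inj (SP _ Sg)).
    by rewrite gwq -eqb -(nth_index (f j) (BV _ Bbh)) -/hi -eqh.
  apply: (no_crossing cardJA sf (SP _ Sg) (SP _ Sh) wqj); rewrite -?ahj //.
    by apply: prefc; [exact: fjV | exact: ca | rewrite idxa].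
  by rewrite -eqb; apply: prefc; [exact: ca | exact: BV | rewrite idxa].
have [x [xp px lox xhi]] := fit_window lop phi (leq_trans kB size_B) k0.
exists x; split=> // [|q /andP[xq qx]]; first exact: leq_trans xhi him.
by apply: unrevealed; rewrite (leq_trans lox xq) -ltnS (leq_trans qx xhi).
Qed.
End Reveal.

(** * The expected logarithm *)

Section LogBounds.
Import Order.TTheory GRing.Theory Num.Theory.
Local Open Scope ring_scope.
Variable R : realType.

Definition log_step (k : nat) : R := ln k.+1%:R - ln k%:R.

Lemma ln_leB1 (x : R) : 0 < x -> ln x <= x - 1.
Proof.
move=> x0; rewrite -[in ln x](subrK 1 x) [_ + 1]addrC le_ln1Dx //.
by rewrite ltrBrDr addNr.
Qed.

Lemma log_step_ge0 k : (0 < k)%N -> 0 <= log_step k.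
Proof.
by move=> k0; rewrite subr_ge0 ler_ln ?posrE ?ltr0n // ler_nat.
Qed.

Lemma log_step_le k : (0 < k)%N -> log_step k <= k%:R^-1.
Proof.
move=> k0; have kp : 0 < k%:R :> R by rewrite ltr0n.
rewrite /log_step -ln_div ?posrE ?ltr0n //.
have -> : k.+1%:R / k%:R = 1 + k%:R^-1 :> R.
  by rewrite -natr1 mulrDl divff ?gt_eqF // mul1r.
by apply: le_ln1Dx; apply: lt_trans (_ : 0 < _); rewrite ?invr_gt0 // ltrN10.
Qed.

Lemma ln_sum_log_step m n : (0 < m <= n)%N ->
  ln m%:R = \sum_(1 <= k < n) (k < m)%N%:R * log_step k.
Proof.
move=> /andP[m0 mn]; rewrite (big_cat_nat m0 mn) /=.
rewrite [X in _ + X]big_nat_cond [X in _ + X]big1 ?addr0; last first.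
  by move=> k /andP[/andP[mk _] _]; rewrite ltnNge mk mul0r.
transitivity (\sum_(1 <= k < m) log_step k); last first.
  by apply: eq_big_nat => k /andP[_ ->]; rewrite mul1r.
by rewrite telescope_sumr // ln1 subr0.
Qed.

(** Multiplied by 12 and exponentiated, this is
    [2 ^ 8 * (3/2) ^ 6 * e ^ 7 <= 3.55 ^ 12], which is true for [e <= 2.8]; the
    bound on [e] comes from [ln (1 - 1/20) <= - 1/20]. *)
Lemma ln_355_ge :
  2 / 3 * log_step 1 + 1 / 2 * log_step 2 + 7 / 12 <= ln (355%:R / 100%:R).
Proof.
have pos (x : R) : 0 < x -> x \in Num.pos by rewrite posrE.
have e_le : 1 <= ln (28 / 10) :> R.
  have ln19 : ln (19 / 20) <= - (1 / 20) :> R.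
    have -> : 19 / 20 = 1 + - (1 / 20) :> R by lra.
    by apply: le_ln1Dx; lra.
  have : 0 <= ln ((28 / 10) * (19 / 20) ^+ 20) :> R by apply: ln_ge0; lra.
  by rewrite lnM ?lnXn ?pos ?exprn_gt0 //; lra.
have : ln (2 ^+ 8 * (3 / 2) ^+ 6 * (28 / 10) ^+ 7)
       <= ln ((355%:R / 100%:R) ^+ 12) :> R.
  by rewrite ler_ln ?pos //; lra.
have ln_prod (a b c : R) : 0 < a -> 0 < b -> 0 < c ->
    ln (a ^+ 8 * b ^+ 6 * c ^+ 7) = ln a *+ 8 + ln b *+ 6 + ln c *+ 7.
  by move=> a0 b0 c0; rewrite !lnM ?lnXn ?pos ?mulr_gt0 ?exprn_gt0.
rewrite ln_prod ?lnXn //; try lra.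
rewrite [ln (3 / 2)]ln_div ?pos // /log_step ln1; lra.
Qed.

(** From [k = 3] on, [2 / (k + 2) * log_step k <= 1 / k - 1 / (k + 2)]
    telescopes to at most [1/3 + 1/4 = 7/12]; the first two terms are too far
    from this estimate and are kept. *)
Lemma sum_log_step_le n :
  \sum_(1 <= k < n) 2 / k.+2%:R * log_step k <= ln (355%:R / 100%:R).
Proof.
pose T m : R := \sum_(1 <= k < m) 2 / k.+2%:R * log_step k.
have TS m : (0 < m)%N -> T m.+1 = T m + 2 / m.+2%:R * log_step m.
  by move=> m0; rewrite /T big_nat_recr.
have bound m : T m.+3 <=
    2 / 3 * log_step 1 + 1 / 2 * log_step 2 + 7 / 12
      - m.+3%:R^-1 - m.+4%:R^-1.
  elim: m => [|m IH].
    rewrite TS // TS // /T big_geq //; lra.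
  have p3 : 0 < m.+3%:R :> R by rewrite ltr0n.
  have p5 : 0 < m.+4.+1%:R :> R by rewrite ltr0n.
  have step : 2 / m.+4.+1%:R * log_step m.+3 <= m.+3%:R^-1 - m.+4.+1%:R^-1.
    have -> : m.+3%:R^-1 - m.+4.+1%:R^-1 = 2 / m.+4.+1%:R / m.+3%:R :> R.
      have E : m.+4.+1%:R = m.+3%:R + 2 :> R by rewrite -natrD addn2.
      have m0 := ler0n R m; rewrite E; field.
      by apply/andP; split; apply: lt0r_neq0; lra.
    by apply: ler_wpM2l; [rewrite divr_ge0 ?ler0n | exact: log_step_le].
  rewrite TS //; apply: le_trans (lerD IH step) _.
  by move: m.+3%:R^-1 m.+4%:R^-1 m.+4.+1%:R^-1 => x y z; lra.
apply: le_trans (_ : T n.+3 <= _).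
  have grow m : T m <= T m.+1.
    case: m => [|m]; first by rewrite /T !big_geq.
    by rewrite (TS m.+1) // lerDl mulr_ge0 ?divr_ge0 ?ler0n ?log_step_ge0.
  exact: le_trans (grow _) (le_trans (grow _) (grow _)).
apply: le_trans (bound n) _; apply: le_trans ln_355_ge.
by rewrite -addrA -opprD gerDl oppr_le0 addr_ge0 // invr_ge0 ler0n.
Qed.

(** Summation by parts: if [P (N >= k) <= 2 / (k + 1)], then
    [E (ln N) = sum_k log_step k * P (N > k)] is at most the
    sum estimated in [sum_log_step_le]. *)
Lemma sum_ln_le (X : finType) (N : X -> nat) :
  (forall x, 0 < N x)%N ->
  (forall k, (0 < k)%N -> (#|[set x | (k <= N x)%N]| * k.+1 <= 2 * #|X|)%N) ->
  \sum_x ln (N x)%:R <= #|X|%:R * ln (355%:R / 100%:R) :> R.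
Proof.
move=> N0 tail; pose n := \max_x N x.
have Nn x : (0 < N x <= n)%N by rewrite N0 leq_bigmax.
rewrite (eq_bigr _ (fun x _ => ln_sum_log_step (Nn x))) exchange_big /=.
apply: le_trans (_ : #|X|%:R * \sum_(1 <= k < n) 2 / k.+2%:R * log_step k <= _).
  rewrite mulr_sumr !big_nat; apply: ler_sum => k /andP[k0 _].
  rewrite -mulr_suml mulrA ler_wpM2r ?log_step_ge0 // -natr_sum.
  rewrite mulrA ler_pdivlMr ?ltr0n // -[2]/2%:R -!natrM ler_nat.
  rewrite [X in (_ <= X)%N]mulnC; apply: leq_trans (tail k.+1 _) => //.
  rewrite leq_mul2r /= -sum1dep_card [leqRHS]big_mkcond /=.
  by apply: leq_sum => x _; case: (k < N x)%N.
by apply: ler_wpM2l; rewrite ?ler0n // sum_log_step_le.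
Qed.
End LogBounds.

(** * Counting the stable matchings *)

Section Count.
Import Order.TTheory GRing.Theory Num.Theory.
Local Open Scope ring_scope.
Variables (R : realType) (J A : finType) (I : sm_instance J A).
Hypothesis cardJA : #|J| = #|A|.

Let S := stable_assignments I.

Let N (o : {perm J}) f j : nat :=
  #|options S (take (rank o j) (listing o)) f j|.

Let N_gt0 o f j : f \in S -> (0 < N o f j)%N.
Proof.
by move=> Sf; rewrite card_gt0; apply/set0Pn; exists (f j); apply: mem_options.
Qed.

(** The entropy bound for one order [o]: sum over [S] the inequality
    [ln x <= x - 1] at [x = #|S| * guess f], where [guess f] is the probability
    of guessing [f]; the right-hand sides add up to at most 0 by [kraft]. *)
Lemma sum_ln_options_ge (o : {perm J}) :
  #|S|%:R * ln #|S|%:R <= \sum_(f in S) \sum_j ln (N o f j)%:R :> R.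
Proof.
have Npos f j : f \in S -> 0 < (N o f j)%:R :> R.
  by move=> ?; rewrite ltr0n N_gt0.
have [S0|S0] := posnP #|S|.
  rewrite S0 mul0r; apply: sumr_ge0 => f Sf; apply: sumr_ge0 => j _.
  by apply: ln_ge0; rewrite ler1n N_gt0.
have Spos : 0 < #|S|%:R :> R by rewrite ltr0n.
pose guess f : R := \prod_j (N o f j)%:R^-1.
have ln_guess f : f \in S ->
    0 < guess f /\ ln (guess f) = - \sum_j ln (N o f j)%:R.
  move=> Sf; rewrite /guess -sumrN.
  elim/big_rec2: _ => [|j x y _ [y0 <-]]; first by rewrite ltr01 ln1.
  rewrite mulr_gt0 ?invr_gt0 ?Npos // lnM ?posrE ?invr_gt0 ?Npos //.
  by rewrite lnV ?posrE ?Npos.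
have sum_guess : \sum_(f in S) guess f <= 1.
  have sep f g : f \in S -> g \in S -> {in listing o, f =1 g} -> f = g.
    by move=> _ _ fg; apply/ffunP=> j; apply/fg/mem_listing.
  apply: le_trans (kraft R (listing_uniq o) sep).
  rewrite le_eqVlt; apply/orP; left; apply/eqP/eq_bigr => f _.
  rewrite big_uniq ?listing_uniq //=; apply: eq_bigl => j.
  by rewrite mem_listing.
have : \sum_(f in S) (ln #|S|%:R - \sum_j ln (N o f j)%:R)
       <= \sum_(f in S) (#|S|%:R * guess f - 1).
  apply: ler_sum => f Sf; have [g0 <-] := ln_guess f Sf.
  rewrite -lnM ?posrE //; apply: ln_leB1; exact: mulr_gt0.
rewrite !sumrB !sumr_const -mulr_sumr => /le_trans sum_le.
rewrite mulr_natl -subr_le0; apply: sum_le.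
by rewrite subr_le0 -[leRHS]mulr1 ler_wpM2l // ltW.
Qed.

(** Averaging the entropy bound over all orders makes the tail bound of
    [reveal_tail] available for each matching and each job separately. *)
Lemma ln_card_stable_le : (0 < #|S|)%N ->
  ln #|S|%:R <= #|J|%:R * ln (355%:R / 100%:R) :> R.
Proof.
move=> S0; pose P := #|{perm J}|.
have P0 : (0 < P)%N by apply/card_gt0P; exists 1%g.
have PS0 : 0 < P%:R * #|S|%:R :> R by rewrite -natrM ltr0n muln_gt0 P0.
rewrite -(ler_pM2l PS0) -!mulrA.
apply: le_trans
  (_ : \sum_(o : {perm J}) \sum_(f in S) \sum_j ln (N o f j)%:R <= _).
  apply: le_trans (ler_sum _ (fun o _ => sum_ln_options_ge o)).
  by rewrite sumr_const -[leRHS]mulr_natl lexx.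
rewrite exchange_big /=.
apply: le_trans
  (_ : \sum_(f in S) \sum_(j : J) P%:R * ln (355%:R / 100%:R) <= _).
  apply: ler_sum => f Sf; rewrite exchange_big /=; apply: ler_sum => j _.
  apply: (@sum_ln_le R {perm J} (fun o => N o f j)) => [o|k k0].
    exact: N_gt0.
  exact: reveal_tail.
rewrite !sumr_const -mulrnA -[leLHS]mulr_natl natrM.
by rewrite le_eqVlt; apply/orP; left; apply/eqP; ring.
Qed.

Lemma num_stable_exp_le :
  (num_stable I)%:R <= (355%:R / 100%:R) ^+ #|J| :> R.
Proof.
apply: le_trans (_ : #|S|%:R <= _); first by rewrite ler_nat num_stable_le.
have base0 : 0 < 355%:R / 100%:R :> R by lra.
have [->|S0] := posnP #|S|; first by rewrite exprn_ge0 // ltW.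
rewrite -ler_ln ?posrE ?ltr0n ?exprn_gt0 // lnXn // -[leRHS]mulr_natl.
exact: ln_card_stable_le.
Qed.
End Count.

Theorem theorem1 :
  exists C : rat, forall n : nat, (0 < n)%N ->
    (forall (J A : finType) (I : sm_instance J A), #|J| = n -> #|A| = n ->
       ((num_stable I)%:R <= (355%:R / 100%:R) ^+ n + C)%R) /\
    ((SM n)%:R <= (355%:R / 100%:R) ^+ n + C)%R.
Proof.
exists 0%R => n _; rewrite GRing.addr0.
have bound (J A : finType) (I : sm_instance J A) : #|J| = n -> #|A| = n ->
    ((num_stable I)%:R <= (355%:R / 100%:R) ^+ n :> rat)%R.
  move=> Jn An; rewrite -(ler_rat Rdefinitions.R).
  (* logarithms need real numbers: compare the rational numbers there *)
  rewrite GRing.rmorphXn GRing.fmorph_div /= !ratr_nat -Jn.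
  exact: (num_stable_exp_le Rdefinitions.R I (etrans Jn (esym An))).
split; first exact: bound.
rewrite /SM; elim/big_ind: _ => [|x y xn yn|I _].
- apply: Num.Theory.exprn_ge0; apply: Num.Theory.divr_ge0;
  exact: Num.Theory.ler0n.
- by rewrite /maxn; case: ifP => _.
- by apply: bound; rewrite card_ord.
Qed.
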